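(* Let $(X,d)$ be a complete metric space, let $m,n\in\mathbb{N}$, and let $\mathcal{F}=\{f_1,\dots,f_n\}$ be a generalized iterated function system (GIFS) of order $m$ on $X$ with fractal $A_{\mathcal F}$. Let $p_1,\dots,p_n>0$ with $p_1+\dots+p_n=1$, and let $P$ be the product probability measure on $\{1,\dots,n\}^{\mathbb{N}}$ generated by the measure $P(\{i\})=p_i$, $i\in\{1,\dots,n\}$. Let $x_0\in X$. For $(\gamma_i)_{i\in\mathbb{N}}\in\{1,\dots,n\}^{\mathbb{N}}$ let $(x_i)_{i\in\mathbb{N}}\subset X$ be the chaos game sequence determined by $x_0$ and $(\gamma_i)$ (defined in the context), and put $K_k:=\overline{\{x_i : i\ge k\}}$ for $k\in\mathbb{N}$. Then with probability $1$ (with respect to $P$, for the random choice of $(\gamma_i)$), $K_k\to A_{\mathcal F}$ as $k\to\infty$ with respect to the Hausdorff-Pompeiu metric; and, moreover, if $x_0\in A_{\mathcal F}$, then with probability $1$, $K_k=A_{\mathcal F}$ for every $k\in\mathbb{N}$.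
   Context: $\mathbb{N}=\{1,2,3,\dots\}$. For a metric space $(X,d)$ and $m\in\mathbb{N}$, $X^m$ carries the maximum metric $d_m((x_1,\dots,x_m),(y_1,\dots,y_m))=\max_i d(x_i,y_i)$. A map $f:X^m\to X$ is a generalized Matkowski contraction (of order $m$) if there is a nondecreasing $\varphi:[0,\infty)\to[0,\infty)$ such that for every $t>0$ the iterates satisfy $\varphi^{(k)}(t)\to0$ as $k\to\infty$ ($\varphi^{(k)}$ is the $k$-fold composition), and $d(f(x),f(y))\le\varphi(d_m(x,y))$ for all $x,y\in X^m$. A GIFS of order $m$ on $X$ is a finite family $\mathcal F=\{f_1,\dots,f_n\}$ of generalized Matkowski contractions of order $m$. If $X$ is complete (and nonempty), there is a unique nonempty compact set $A_{\mathcal F}\subset X$ with $A_{\mathcal F}=\bigcup_{i=1}^n f_i(A_{\mathcal F}\times\dots\times A_{\mathcal F})$ (known result); it is called the fractal (attractor) generated by $\mathcal F$. The Hausdorff-Pompeiu metric is the usual Hausdorff distance (between nonempty closed bounded sets). Enumeration $H$. Define $H(j,k)\in\mathbb{N}$ for pairs $(j,k)\in\mathbb{N}\times\mathbb{N}$ recursively: $H(1,1):=1$; and if $H(j,k)$ is defined, then: if $j \bmod m\ne 0$, set $H(m^{k-1}j+1,1):=H(j,k)+1$; if $j\bmod m=0$, set $H(j/m,k+1):=H(j,k)+1$. For $m\ge2$ this defines a bijection $H:\mathbb{N}\times\mathbb{N}\to\mathbb{N}$. For $m=1$ it defines $H$ only at the pairs $(1,k)$, with $H(1,k)=k$, and only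 these pairs are used. In all cases each $i\in\mathbb{N}$ is $H(j,k)$ for exactly one pair $(j,k)$ at which $H$ is defined. Chaos game sequence. Given $x_0\in X$ and $(\gamma_i)\in\{1,\dots,n\}^{\mathbb{N}}$, define $(x_i)_{i\in\mathbb{N}}$ recursively: $x_i:=f_{\gamma_i}(x_0,\dots,x_0)$ for $i=1,\dots,m$. For $i\ge m+1$ with $i=H(j,k)$: - if $k>1$, then $x_i:=f_{\gamma_i}\left(x_{H(mj-m+1,k-1)},x_{H(mj-m+2,k-1)},\dots,x_{H(mj,k-1)}\right)$; - if $k=1$, then $x_i:=f_{\gamma_i}(x',\dots,x')$, where $x':=x_l$ and $l=H(j',k')$ is the maximal number such that $l<i$ and $k'>1$. *)

(* Defs.v *)
(* MathComp-Analysis development, over an arbitrary [R : realType]. *)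
From HB Require Import structures.
From mathcomp Require Import all_boot all_order all_algebra.
From mathcomp Require Import all_classical all_reals all_analysis.
From mathcomp Require Import zify.

Set Implicit Arguments.
Unset Strict Implicit.
Unset Printing Implicit Defensive.

Import Order.TTheory GRing.Theory Num.Theory.
Import numFieldNormedType.Exports.

Local Open Scope classical_set_scope.
Local Open Scope ring_scope.

#[short(type="completeMetricType")]
HB.structure Definition CompleteMetric (R : numDomainType) :=
  {T of Metric R T & Complete T}.

(* [g_sigma_algebraType] requires a pointed carrier. *)
HB.instance Definition _ (n : nat) := isPointed.Build 'I_n.+1 ord0.

Section GIFS.
Context {R : realType} {X : metricType R}.

(* X^m is represented by ['I_m -> X]. *)
Definition max_dist (m : nat) (x y : 'I_m -> X) : R :=
  \big[Num.max/0]_(i < m) mdist (x i) (y i).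

Definition generalized_matkowski (m : nat) (f : ('I_m -> X) -> X) : Prop :=
  exists phi : R -> R,
    [/\ forall t, 0 <= t -> 0 <= phi t,
        forall s t, 0 <= s -> s <= t -> phi s <= phi t,
        forall t, 0 < t -> iter k phi t @[k --> \oo] --> (0 : R)
      & forall x y, mdist (f x) (f y) <= phi (max_dist x y)].

Definition is_fractal (m n : nat) (f : 'I_n -> ('I_m -> X) -> X) (A : set X) :
    Prop :=
  [/\ A !=set0, compact A
    & A = \bigcup_(i in [set: 'I_n]) (f i @` [set x | forall l, A (x l)])].

(* With values in the extended reals, so that no boundedness is presupposed:
   between nonempty bounded sets these are the usual real-valued distances,
   and [hausdorff_dist A B = +oo] if A, B are nonempty and exactly one of them
   is bounded. *)
Definition dist_to_set (x : X) (B : set X) : \bar R :=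
  ereal_inf [set (mdist x b)%:E | b in B].

Definition hausdorff_dist (A B : set X) : \bar R :=
  maxe (ereal_sup [set dist_to_set a B | a in A])
       (ereal_sup [set dist_to_set b A | b in B]).

End GIFS.

(* The graph of the enumeration H: [H_graph m j k i] means that H(j,k) is
   defined and equal to i. *)
Inductive H_graph (m : nat) : nat -> nat -> nat -> Prop :=
| H_start : H_graph m 1 1 1
| H_newrow (j k i : nat) : H_graph m j k i -> (j %% m != 0)%N ->
    H_graph m (m ^ (k - 1) * j + 1)%N 1 i.+1
| H_nextcol (j k i : nat) : H_graph m j k i -> (j %% m == 0)%N ->
    H_graph m (j %/ m)%N k.+1 i.+1.

(* The value H(j,k); it is 0 if H is not defined at (j,k). *)
Definition H_val (m j k : nat) : nat := xget 0%N [set i | H_graph m j k i].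

(* Sequences indexed by {1, 2, ...}: the choice gamma_i is [g (i - 1)], while
   x_i is [x i] and [x 0] is unconstrained.  In the second clause [l] is the
   zero-based position of an argument, so that the arguments are the x_i with
   i = H(mj-m+1,k-1), ..., H(mj,k-1). *)
Definition chaos_game (X : Type) (m n : nat) (f : 'I_n -> ('I_m -> X) -> X)
    (x0 : X) (g : nat -> 'I_n) (x : nat -> X) : Prop :=
  [/\ forall i, (1 <= i <= m)%N -> x i = f (g (i - 1)%N) (fun=> x0),
      forall i j k, (m < i)%N -> H_graph m j k i -> (1 < k)%N ->
        x i = f (g (i - 1)%N)
                (fun l : 'I_m => x (H_val m (m * j - m + (l + 1)) (k - 1)))
    & forall i j i', (m < i)%N -> H_graph m j 1 i ->
        let later_column l :=
          (l < i)%N /\ (exists j' k', (1 < k')%N /\ H_graph m j' k' l) in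
        later_column i' -> (forall l, later_column l -> (l <= i')%N) ->
        x i = f (g (i - 1)%N) (fun=> x i')].

Local Close Scope ring_scope.
Local Open Scope nat_scope.

Section H_graph_facts.
Variables (m : nat) (m0 : (0 < m)%N).

Lemma H_graph_gt0 j k i : H_graph m j k i -> [/\ 0 < j, 0 < k & 0 < i]%N.
Proof.
elim=> {j k i} [//|j k i _ [j0 k0 i0] _|j k i _ [j0 k0 i0] jm]; split => //.
  by rewrite addn1.
by rewrite divn_gt0// dvdn_leq.
Qed.

Lemma H_graph_col j k i : H_graph m j k.+2 i ->
  exists2 i', i = i'.+1 & H_graph m (m * j) k.+1 i'.
Proof.
move E : k.+2 => k2 h; case: h E => // {}j k' i' h jm [E]; subst k'.
exists i' => //; rewrite mulnC divnK//.
Qed.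

Lemma H_graph_row j i : H_graph m j 1 i -> (1 < j)%N ->
  exists i' j' k, [/\ i = i'.+1, H_graph m j' k i', (j' %% m != 0)%N
    & j = (m ^ (k - 1) * j' + 1)%N].
Proof.
move E : 1%N => k h; case: h E => // [j' k' i' h jm _ _|j' k' i' h jm [k'0]].
  by exists i', j', k'.
by have [] := H_graph_gt0 h; rewrite -k'0.
Qed.

Lemma H_graph_first i : H_graph m 1 1 i -> i = 1%N.
Proof.
move E1 : {1}1%N => j; move E : {1}1%N => k h.
case: h E1 E => // [j' k' i' h _|j' k' i' h jm _ [k'0]].
  have [j0 _ _] := H_graph_gt0 h.
  by have := muln_gt0 (m ^ (k' - 1)) j'; rewrite expn_gt0 m0 j0/=; lia.
by have [] := H_graph_gt0 h; rewrite -k'0.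
Qed.

Lemma H_graph_pair i j k j' k' :
  H_graph m j k i -> H_graph m j' k' i -> j = j' /\ k = k'.
Proof.
move=> h; elim: h j' k' => {j k i} [j' k'|j k i h IH jm j' k'|j k i h IH jm j' k'].
- move E : 1%N => i h; case: h E => // ? ? ? /H_graph_gt0[_ _]; lia.
- move E : i.+1 => i1 h'; case: h' E.
  + by move=> [i0]; have [_ _] := H_graph_gt0 h; rewrite i0.
  + by move=> j1 k1 i2 h1 _ [E]; subst i2; have [-> ->] := IH _ _ h1.
  + by move=> j1 k1 i2 h1 + [E]; subst i2; have [<- _] := IH _ _ h1; rewrite (negbTE jm).
- move E : i.+1 => i1 h'; case: h' E.
  + by move=> [i0]; have [_ _] := H_graph_gt0 h; rewrite i0.
  + by move=> j1 k1 i2 h1 + [E]; subst i2; have [<- _] := IH _ _ h1; rewrite jm.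
  + by move=> j1 k1 i2 h1 _ [E]; subst i2; have [-> ->] := IH _ _ h1.
Qed.

Lemma H_graph_total i : (0 < i)%N -> exists j k, H_graph m j k i.
Proof.
elim: i => // -[_ _|i /(_ isT)[j [k h]] _]; first by exists 1%N, 1%N; exact: H_start.
have [jm|jm] := boolP (j %% m == 0)%N; do 2!eexists; [exact: H_nextcol h jm|exact: H_newrow h jm].
Qed.

Lemma H_graph_inj j k i i' : H_graph m j k i -> H_graph m j k i' -> i = i'.
Proof.
elim/ltn_ind: i j k i' => i IH j [|[|k]] i'.
- by move/H_graph_gt0 => [].
- move=> h h'; have [j1|j1] := leqP j 1.
    have E : j = 1%N by have [] := H_graph_gt0 h; lia.
    by subst j; rewrite (H_graph_first h) (H_graph_first h').
  have [a [b [c [ia hb bm E]]]] := H_graph_row h j1.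
  have [a' [b' [c' [ia' hb' bm' E']]]] := H_graph_row h' j1.
  subst i i'; congr S.
  have m1 : (1 < m)%N by case: m m0 bm => [//|[|//]] _; rewrite modn1.
  have [_ c0 _] := H_graph_gt0 hb; have [_ c0' _] := H_graph_gt0 hb'.
  have wl u v x y : (u <= v)%N -> (m ^ u * x = m ^ v * y)%N -> (x %% m != 0)%N -> u = v.
    move=> uv + xm; rewrite -(subnKC uv) expnD -mulnA => /eqP.
    rewrite eqn_pmul2l ?expn_gt0 ?m0// => /eqP xE; move: xm; rewrite xE.
    by case: (v - u)%N => [|w]; [rewrite addn0|rewrite expnS -mulnA modnMr].
  have EE : (m ^ (c - 1) * b = m ^ (c' - 1) * b')%N by lia.
  have cc : c = c'.
    suff : (c - 1 = c' - 1)%N by lia.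
    have [le|le] := leqP (c - 1)%N (c' - 1)%N; first exact: wl EE bm.
    by apply/esym; apply: wl (esym EE) bm'; exact: ltnW.
  subst c'; apply: (IH a _ b c) => //.
  move: EE => /eqP; rewrite eqn_pmul2l ?expn_gt0 ?m0// => /eqP bb.
  by rewrite bb.
- move=> /H_graph_col[a E ha] /H_graph_col[a' -> ha']; subst i; congr S.
  exact: (IH _ (ltnSn _) _ _ _ ha ha').
Qed.

Lemma H_graph_prev j k i : H_graph m j.+1 k i -> (0 < j)%N ->
  exists2 i', (i' < i)%N & H_graph m j k i'.
Proof.
move=> h j0; elim/ltn_ind: i j k h j0 => i IH j [|[|k]] h j0.
- by have [] := H_graph_gt0 h.
- have [a [b [c [-> hb _]]]] := H_graph_row h (ltac:(lia) : (1 < j.+1)%N).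
  rewrite addn1 => -[->] {IH h j j0 i}.
  suff : exists2 i', (i' <= a)%N & H_graph m (m ^ (c - 1) * b) 1 i'.
    by move=> [i' ? ?]; exists i'.
  case: c hb => [/H_graph_gt0[]//|c]; rewrite subn1/=.
  elim: c a b => [a b h|c IH a b h]; first by exists a; rewrite ?mul1n.
  have [a' -> h'] := H_graph_col h; have [i' ia' hi'] := IH _ _ h'.
  by exists i'; [lia|rewrite expnSr -mulnA].
- have [a E ha] := H_graph_col h; subst i.
  suff : forall d, (d <= m)%N -> exists2 i', (i' + d <= a)%N & H_graph m (m * j.+1 - d) k.+1 i'.
    move=> /(_ m (leqnn _)) [i' ia hi']; exists i'.+1; first by lia.
    rewrite [j](_ : _ = ((m * j.+1 - m) %/ m)%N).
      by apply: H_nextcol => //; rewrite mulnS addKn modnMr.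
    by rewrite mulnS addKn mulKn.
  elim=> [_|d IHd dm]; first by exists a; rewrite ?subn0 ?addn0.
  have [i' ia' hi'] := IHd (ltnW dm).
  have [|||b bi' hb] := IH i' _ (m * j.+1 - d.+1)%N k.+1.
  + by lia.
  + suff -> : (m * j.+1 - d.+1).+1 = (m * j.+1 - d)%N by [].
    by rewrite mulnS; lia.
  + by rewrite mulnS; have := muln_gt0 m j; rewrite m0 j0/=; lia.
  by exists b => //; lia.
Qed.

Lemma H_val_graph j k i : H_graph m j k i -> H_val m j k = i.
Proof.
move=> h; apply: (@H_graph_inj j k) => //.
exact: (@xgetPex _ 0%N [set i | H_graph m j k i]%classic (ex_intro _ i h)).
Qed.

Lemma H_graph_arg j k i (l : nat) : H_graph m j k i -> (1 < k)%N -> (l < m)%N ->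
  exists2 i', (i' < i)%N & H_graph m (m * j - m + (l + 1)) (k - 1) i'.
Proof.
case: k => [//|[//|k]] h _ lm; rewrite subn1/=.
have [a -> ha] := H_graph_col h; have [j0 _ _] := H_graph_gt0 h.
suff : forall d, (d < m)%N -> exists2 i', (i' <= a)%N & H_graph m (m * j - d) k.+1 i'.
  move=> /(_ (m - l.+1)%N)[|i' ia hi']; first by lia.
  exists i' => //; rewrite (_ : _ + _ = m * j - (m - l.+1))%N//.
  by case: j j0 {h ha hi'} => // j _; rewrite mulnS; lia.
case: j j0 {h} ha => // j _ ha.
elim=> [_|d IHd dm]; first by exists a; rewrite ?subn0.
have [i' ia' hi'] := IHd (ltnW dm).
have [||b bi' hb] := @H_graph_prev (m * j.+1 - d.+1)%N k.+1 i'.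
+ suff -> : (m * j.+1 - d.+1).+1 = (m * j.+1 - d)%N by [].
  by rewrite mulnS; lia.
+ by rewrite mulnS; lia.
by exists b => //; lia.
Qed.

End H_graph_facts.

Lemma causal_rec (X : Type) (d : X) (F : nat -> (nat -> X) -> X) :
  (forall i u v, (forall l, (l < i)%N -> u l = v l) -> F i u = F i v) ->
  exists x, forall i, x i = F i x.
Proof.
move=> cF.
pose s := fix s i := match i with 0 => (fun=> d)
  | i'.+1 => fun l => if (l < i')%N then s i' l else F i' (s i') end.
have sS i l : (l < i)%N -> s i.+1 l = s i l by move=> /= ->.
have sd i e l : (l < i)%N -> s (e + i)%N l = s i l.
  by move=> li; elim: e => [//|e IH]; rewrite addSn sS ?IH//; lia.
exists (fun i => s i.+1 i) => i; rewrite [LHS]/= ltnn; apply: cF => l li.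
by rewrite -(subnK li) sd.
Qed.

Lemma later_col m : (0 < m)%N -> forall i, (m < i)%N ->
  exists2 l, (l <= m.+1)%N & exists j' k', (1 < k')%N /\ H_graph m j' k' l.
Proof.
move=> m0 i mi.
have hr r : (r < m)%N -> H_graph m r.+1 1 r.+1.
  elim: r => [_|r IH rm]; first exact: H_start.
  have := H_newrow (IH (ltnW rm)); rewrite mul1n addn1; apply.
  by rewrite modn_small//.
exists m.+1 => //; exists (m %/ m)%N, 2%N; split => //.
apply: H_nextcol; last by rewrite modnn.
by case: m m0 hr {mi} => // m _ /(_ m (ltnSn _)).
Qed.

(* For m > 0 the chaos game sequence exists, and it is unique away from the
   unused index 0. *)
Lemma chaos_game_ex (X : Type) (m n : nat) (f : 'I_n -> ('I_m -> X) -> X)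
    (x0 : X) (g : nat -> 'I_n) : (0 < m)%N -> exists x, chaos_game f x0 g x.
Proof.
move=> m0.
pose L i := [set l | (l < i)%N /\ exists j' k', (1 < k')%N /\ H_graph m j' k' l]%classic.
pose M i := [set l | L i l /\ forall l', L i l' -> (l' <= l)%N]%classic.
pose Q i := [set jk : nat * nat | H_graph m jk.1 jk.2 i]%classic.
pose F i (x : nat -> X) :=
  let jk := xget (0, 0)%N (Q i) in
  f (g (i - 1)%N) (fun l : 'I_m =>
    if (i <= m)%N then x0 else if (1 < jk.2)%N then
      x (H_val m (m * jk.1 - m + (l + 1)) (jk.2 - 1))
    else let i' := xget 0%N (M i) in if (i' < i)%N then x i' else x0).
have QE i j k : H_graph m j k i -> xget (0, 0)%N (Q i) = (j, k).
  move=> h; have /= := @xgetPex _ (0,0)%N (Q i) (ex_intro _ (j, k) h).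
  case: (xget _ _) => a b /=; rewrite /Q/= => h'.
  by have [-> ->] := H_graph_pair m0 h' h.
have [|x Fx] := @causal_rec X x0 F.
  move=> i u v uv; rewrite /F; congr (f _ _); apply/funext => l.
  have [//|mi] := leqP i m.
  have [|j [k h]] := @H_graph_total m i; first by lia.
  rewrite (QE _ _ _ h)/=; case: ifPn => [k1|_].
    have [i' i'i h'] := H_graph_arg m0 h k1 (ltn_ord l).
    by rewrite (H_val_graph m0 h') uv.
  by case: ifP => [/uv|].
exists x; split.
- move=> i /andP[i1 im]; rewrite Fx /F; congr (f _ _); apply/funext => l.
  by rewrite im.
- move=> i j k mi h k1; rewrite Fx /F; congr (f _ _); apply/funext => l.
  by rewrite leqNgt mi/= (QE _ _ _ h)/= k1.
- move=> i j i' mi h lc li' mx; rewrite Fx /F; congr (f _ _); apply/funext => l.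
  rewrite leqNgt mi/= (QE _ _ _ h)/=.
  have [Lx Mx] := @xgetPex _ 0%N (M i) (ex_intro _ i' (conj li' mx)).
  have -> : xget 0%N (M i) = i'.
    by apply/eqP; rewrite eqn_leq mx// Mx.
  by case: li' => ->.
Qed.

Lemma chaos_game_uniq (X : Type) (m n : nat) (f : 'I_n -> ('I_m -> X) -> X)
    (x0 : X) (g : nat -> 'I_n) x y : (0 < m)%N ->
   chaos_game f x0 g x -> chaos_game f x0 g y -> forall i, (0 < i)%N -> x i = y i.
Proof.
move=> m0 [x1 x2 x3] [y1 y2 y3]; elim/ltn_ind => i IH i0.
have [im|mi] := leqP i m; first by rewrite x1 ?y1 ?i0.
have [j [[|[|k]] h]] := @H_graph_total m i i0.
- by have [] := H_graph_gt0 m0 h.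
- have mi2 : (m.+1 < i)%N.
    rewrite ltn_neqAle mi andbT; apply/eqP => E; subst i.
    have [l lm [j' [k' [k1 h']]]] := later_col m0 mi.
    move: lm; rewrite leq_eqVlt => /orP[/eqP E|lm].
      by subst l; have [_ E] := H_graph_pair m0 h h'; rewrite -E in k1.
    have hr r : (r < m)%N -> H_graph m r.+1 1 r.+1.
      elim: r => [_|r IHr rm]; first exact: H_start.
      have := H_newrow (IHr (ltnW rm)); rewrite mul1n addn1; apply.
      by rewrite modn_small//.
    have [_ _] := H_graph_gt0 m0 h'; case: l lm h' => // l lm h' _.
    by have [_ E] := H_graph_pair m0 h' (hr l (ltac:(lia))); rewrite E in k1.
  have [l lm lc] := later_col m0 mi.
  have ex : exists l, (l < i)%N && `[< exists j' k', (1 < k')%N /\ H_graph m j' k' l >].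
    by exists l; apply/andP; split; [lia|apply/asboolP].
  have bd l' : (l' < i)%N && `[< exists j' k', (1 < k')%N /\ H_graph m j' k' l' >] -> (l' <= i)%N.
    by move=> /andP[/ltnW].
  case: (ex_maxnP ex bd) => a /andP[ai /asboolP ha] amax.
  have A1 : (a < i)%N /\ exists j' k', (1 < k')%N /\ H_graph m j' k' a by [].
  have A2 b : (b < i)%N /\ (exists j' k', (1 < k')%N /\ H_graph m j' k' b) -> (b <= a)%N.
    by move=> [bi hb]; apply: amax; apply/andP; split => //; apply/asboolP.
  have a0 : (0 < a)%N by have [j' [k' [_ /(H_graph_gt0 m0)[]]]] := ha.
  by rewrite (x3 _ _ _ mi h A1 A2) (y3 _ _ _ mi h A1 A2) IH.
- rewrite (x2 _ _ _ mi h isT) (y2 _ _ _ mi h isT); congr (f _ _); apply/funext => l.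
  have [i' i'i h'] := H_graph_arg m0 h isT (ltn_ord l).
  rewrite (H_val_graph m0 h') IH//.
  by have [] := H_graph_gt0 m0 h'.
Qed.

Local Close Scope nat_scope.
Local Open Scope ring_scope.

Definition tail_closure (X : topologicalType) (x : nat -> X) (k : nat) : set X :=
  closure [set x i | i in [set i | (k <= i)%N]].

(* The generators of the product sigma-algebra of {1, ..., n}^N, the finite
   alphabet carrying the discrete sigma-algebra. *)
Definition coordinate_events (T : Type) : set (set (nat -> T)) :=
  [set C | exists i a, C = [set g | g i = a]].

Definition is_product_probability (R : realType) (n : nat) (p : 'I_n.+1 -> R)
    (P : probability (g_sigma_algebraType (@coordinate_events 'I_n.+1)) R) :
    Prop :=
  forall (N : nat) (B : nat -> {set 'I_n.+1}),
    P [set g | forall i, (i < N)%N -> g i \in B i] =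
    (\prod_(i < N) \sum_(a in B i) p a)%:E.

(* Main.v *)
Require Import Defs.
From HB Require Import structures.
From mathcomp Require Import all_boot all_order all_algebra.
From mathcomp Require Import all_classical all_reals all_analysis.
From mathcomp Require Import zify lra ring.
Import Order.TTheory GRing.Theory Num.Theory.
Import numFieldNormedType.Exports.
Local Open Scope classical_set_scope.
Local Open Scope ring_scope.

Set Implicit Arguments.
Unset Strict Implicit.

(** The enumeration H is the post-order traversal of an infinite [m]-ary
    forest: the pair (j, k) is a node of height k, its children are the nodes
    (mj - m + l, k - 1) with 1 <= l <= m, and the leaves are the pairs (j, 1).
    The complete tree of height K below a node of height K therefore occupies a
    block of [tree_size m K] consecutive indices that ends at that node
    ([H_graph_fill], [H_graph_children]).  The recursion of the chaos game
    evaluates these trees bottom up: a node of height K carries the value of a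
    K-fold nested composition of the maps, and the K-level pattern of maps is
    read off from the letters of the block.

    Two facts give the theorem.  Let psi be a common comparison function of all
    the maps ([common_comparison]).

    The orbit is attracted by A, for every sequence of letters.  Each x_i is
    the image under some map of terms whose indices are at least i/m - 1
    ([chaos_game_step]), so the distance bound to A, initially D, improves to
    psi D, psi (psi D), and so on, each time after finitely many indices
    ([chaos_game_attracted]).

    Every point a of A is almost surely a cluster point of the orbit.
    Unfolding A as the union of the images of its powers K times writes a as a
    K-fold nested composition evaluated at points of A; this yields a word of
    length [tree_size m K] such that, whenever the word fills the block of a
    tree of height K, the term at its root is within psi^K r of a, where r
    bounds the distances between the orbit and A ([tree_word_exists]).  Trees
    of height K occupy blocks arbitrarily far out ([tree_root_unbounded]), so
    one can choose infinitely many disjoint ones.  The letters on disjoint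
    blocks are independent, and a prescribed word appears in each block with
    the same positive probability; hence almost surely it appears in infinitely
    many of them ([ae_word_recurs]).  There are countably many words, so the
    exceptional null set can be taken common to all of them
    ([ae_tree_words]).

    The second fact puts A inside every closed tail, and the first one puts the
    closed tails inside small neighbourhoods of A: this is convergence for the
    Hausdorff distance.  If x_0 is in A then all the x_i are in A, and A is
    closed, so the closed tails are equal to A. *)

(** * The enumeration as a post-order traversal *)

Section PostOrder.
Local Open Scope nat_scope.

Fixpoint tree_size (m k : nat) : nat :=
  if k is k'.+1 then (m * tree_size m k').+1 else 0.

(** The induction step of [H_graph_fill]: once every tree of height k + 1 that
    is entered at its first leaf gets traversed completely, the m children of
    a node of height k + 2 are reached one after the other, because the index
    after the l-th child, l < m, is the first leaf below the (l + 1)-st. *)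
Lemma H_graph_siblings (m k b t : nat) : 0 < m ->
  (forall c i, H_graph m (m ^ k * c + 1) 1 i.+1 ->
    H_graph m c.+1 k.+1 (i + tree_size m k.+1)) ->
  H_graph m (m ^ k.+1 * b + 1) 1 t.+1 ->
  forall l, l < m ->
    H_graph m (m * b + l.+1) k.+1 (t + l.+1 * tree_size m k.+1).
Proof.
move=> m0 fill ht; elim=> [_|l IH lm].
  by rewrite mul1n addn1; apply: fill; rewrite mulnA -expnSr.
have hl := IH (ltnW lm).
have /fill : H_graph m (m ^ k * (m * b + l.+1) + 1) 1
    (t + l.+1 * tree_size m k.+1).+1.
  have := H_newrow hl; rewrite subn1 /=; apply.
  by rewrite mulnC modnMDl modn_small.
by rewrite -addnS -addnA -mulSnr.
Qed.

(** Post-order: a tree entered at its first leaf, with index i + 1, is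
    enumerated without interruption, and its root comes last. *)
Lemma H_graph_fill (m k b i : nat) : 0 < m ->
  H_graph m (m ^ k * b + 1) 1 i.+1 ->
  H_graph m b.+1 k.+1 (i + tree_size m k.+1).
Proof.
move=> m0; elim: k b i => [|k IH] b i h.
  by move: h; rewrite /= muln0 expn0 mul1n !addn1.
have := H_graph_siblings m0 IH h (l := m.-1).
rewrite prednK // => /(_ (leqnn _)) /H_nextcol.
by rewrite -mulnSr mulKn // modnMr -addnS; apply.
Qed.

Lemma H_graph_first_leaf (m k b i : nat) : 0 < m ->
  H_graph m b.+1 k.+1 i -> exists i', H_graph m (m ^ k * b + 1) 1 i'.+1.
Proof.
move=> m0; elim: k b i => [|k IH] b i h.
  rewrite expn0 mul1n addn1; have [_ _] := H_graph_gt0 m0 h.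
  by case: i h => // i h _; exists i.
have [i' _] := H_graph_arg m0 h isT m0.
have -> : m * b.+1 - m + (0 + 1) = (m * b).+1.
  by rewrite mulnS addKn add0n addn1.
by rewrite subn1 => /IH [a]; rewrite mulnA -expnSr => ha; exists a.
Qed.

(** A node is the last index of the block of its tree, and its children are
    the last indices of m consecutive sub-blocks. *)
Lemma H_graph_children (m b k i : nat) : 0 < m -> H_graph m b.+1 k.+2 i ->
  exists2 t, i = t + tree_size m k.+2 &
    forall l, l < m ->
      H_graph m (m * b + l.+1) k.+1 (t + l.+1 * tree_size m k.+1).
Proof.
move=> m0 h; have [t ht] := H_graph_first_leaf m0 h.
exists t; first exact: (H_graph_inj m0 h (H_graph_fill m0 ht)).
by apply: H_graph_siblings ht => // c a; exact: H_graph_fill.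
Qed.

(** The enumeration climbs from (b, k) as long as the first component is
    divisible by m. The node climbed to, (b', k'), satisfies
    m^(k' - 1) b' = m^(k - 1) b, so the leaf entered afterwards can be predicted. For m = 1
    the climb never ends. *)
Lemma H_graph_next_leaf (m b k i : nat) : 1 < m -> H_graph m b k i ->
  exists2 i', i < i' & H_graph m (m ^ (k - 1) * b + 1) 1 i'.
Proof.
move=> m1; elim/ltn_ind: b k i => b IH k i h.
have [bm|bm] := boolP (b %% m == 0); last first.
  by exists i.+1 => //; exact: H_newrow.
have [b0 k0 _] := H_graph_gt0 (ltnW m1) h.
have [i' ii' h'] := IH _ (ltn_Pdiv m1 b0) _ _ (H_nextcol h bm).
exists i'; first exact: ltnW.
have -> : m ^ (k - 1) * b = m ^ (k.+1 - 1) * (b %/ m); last by [].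
by rewrite -{1}(divnK bm) mulnCA mulnC -expnSr -subSn //.
Qed.

Lemma H_graph_leaf (m b : nat) : 1 < m -> exists2 i, b < i & H_graph m b.+1 1 i.
Proof.
move=> m1; elim: b => [|b [i bi /(H_graph_next_leaf m1) [i' ii']]].
  by exists 1 => //; exact: H_start.
by rewrite mul1n addn1 => h; exists i' => //; exact: leq_ltn_trans ii'.
Qed.

Lemma H_graph_order1 (i : nat) : H_graph 1 1 i.+1 i.+1.
Proof.
by elim: i => [|i /H_nextcol]; [exact: H_start|rewrite divn1; apply].
Qed.

Lemma tree_size_order1 (k : nat) : tree_size 1 k = k.
Proof. by elim: k => //= k ->; rewrite mul1n. Qed.

(** An index i = H(j, k) below which a complete tree of height K hangs in the
    block that ends at i. For m >= 2 these are the nodes of height exactly K,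
    since the upper K levels of a higher tree need not be contiguous. For
    m = 1 the forest is a single path, with only one node of each height, and
    every node of height at least K ends a path of K nodes. *)
Definition tree_root (m K j k i : nat) : Prop :=
  H_graph m j k i /\ (k = K \/ m = 1 /\ K <= k).

Lemma tree_root_unbounded (m K M : nat) : 0 < m ->
  exists j k t, M <= t /\ tree_root m K.+1 j k (t + tree_size m K.+1).
Proof.
rewrite leq_eqVlt => /orP[/eqP <-|m1].
  exists 1, (M + K).+1, M; split => //.
  rewrite tree_size_order1 addnS; split; first exact: H_graph_order1.
  by right; split => //; rewrite ltnS leq_addl.
have [i Mi] := H_graph_leaf (m ^ K * M) m1; case: i Mi => // i Mi.
rewrite -addn1 => /(H_graph_fill (ltnW m1)) h.
exists M.+1, K.+1, i; split; last by split => //; left.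
by rewrite (leq_trans _ (Mi : _ <= i)) // leq_pmull // expn_gt0 ltnW.
Qed.

(** Going backwards from a leaf that directly follows another leaf lowers its
    row by one; a leaf whose row exceeds a positive multiple of m by one
    follows an inner node. So an inner node is met within m steps. *)
Lemma later_column_recent (m b i : nat) : 0 < m -> m <= b ->
  H_graph m b.+1 1 i -> exists l j' k',
    [/\ l < i, i <= l + m, 1 < k' & H_graph m j' k' l].
Proof.
move=> m0.
suff : m <= b -> H_graph m b.+1 1 i -> exists l j' k',
    [/\ l < i, i <= l + (b %% m).+1, 1 < k' & H_graph m j' k' l].
  move=> + mb h => /(_ mb h) [l [j' [k' [li il k1 hl]]]].
  exists l, j', k'; split => //; apply: leq_trans il _.
  by rewrite leq_add2l ltn_mod.
elim: b i => [|b IH] i mb h; first by rewrite leqNgt m0 in mb.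
have [i' [j' [k' [-> h' jm]]]] := H_graph_row m0 h isT.
have [k1 E|k1 _] := leqP k' 1; last first.
  by exists i', j', k'; split=> //; rewrite addnS ltnS leq_addr.
have k'1 : k' = 1.
  by apply/eqP; rewrite eqn_leq k1; have [_ ->] := H_graph_gt0 m0 h'.
move: E h' jm; rewrite {}k'1 mul1n addn1 => -[<-] h' jm {j' k' k1}.
have mb' : m <= b.
  rewrite leqNgt; apply: contra jm => bm.
  have -> : b.+1 = m by apply/eqP; rewrite eqn_leq bm mb.
  by rewrite modnn.
have [l [j' [k' [li il k1 hl]]]] := IH _ mb' h'.
exists l, j', k'; split => //; first exact: ltnW.
suff -> : b.+1 %% m = (b %% m).+1 by rewrite addnS ltnS.
rewrite -addn1 -modnDml addn1 modn_small // ltn_neqAle ltn_mod m0 andbT.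
by apply: contra jm => /eqP E; rewrite -addn1 -modnDml addn1 E modnn.
Qed.

Lemma H_graph_initial (m r : nat) : r < m -> H_graph m r.+1 1 r.+1.
Proof.
elim: r => [_|r IH rm]; first exact: H_start.
by have := H_newrow (IH (ltnW rm)); rewrite mul1n addn1 modn_small //; apply.
Qed.

Lemma tree_root_children (m K j k t : nat) : 0 < m ->
  tree_root m K.+2 j k (t + tree_size m K.+2) ->
  exists b k', [/\ j = b.+1, k = k'.+2 & forall l, l < m ->
    tree_root m K.+1 (m * b + l.+1) k'.+1 (t + l.+1 * tree_size m K.+1)].
Proof.
move=> m0 [h kK]; have Kk : K.+2 <= k by case: kK => [->|[]].
case: j k h kK Kk => [|b] [|[|k]] // h; first by have [] := H_graph_gt0 m0 h.
move=> kK Kk; exists b, k; split => // l lm.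
have [t' E /(_ _ lm) hl] := H_graph_children m0 h.
case: kK => [[kK]|[m1 _]].
  by subst k; move/addIn: E => ->; split => //; left.
subst m; case: l lm hl => // _; rewrite !tree_size_order1 in E *.
have -> : t' + 1 * k.+1 = t + 1 * K.+1 by lia.
by split => //; right.
Qed.

End PostOrder.

(** * The chaos game as an evaluation of trees *)

Section ChaosGame.
Local Open Scope nat_scope.

Lemma chaos_game_column (X : Type) (m n : nat) (f : 'I_n -> ('I_m -> X) -> X)
    (x0 : X) (g : nat -> 'I_n) (x : nat -> X) (b k i : nat) (s : nat -> nat) :
  0 < m -> chaos_game f x0 g x -> m < i -> H_graph m b.+1 k.+2 i ->
  (forall l, l < m -> H_graph m (m * b + l.+1) k.+1 (s l)) ->
  x i = f (g (i - 1)) (fun l => x (s l)).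
Proof.
move=> m0 [_ xtree _] mi h hs; rewrite (xtree _ _ _ mi h isT).
congr (f _ _); apply/funext => l; congr x.
rewrite subn1 /= mulnS addKn addn1.
exact: (H_val_graph m0 (hs _ (ltn_ord l))).
Qed.

(** The two recursive clauses in one form. The bound i <= m (a l + 1) is what
    is needed to know that the arguments of late terms are late terms. *)
Lemma chaos_game_step (X : Type) (m n : nat) (f : 'I_n -> ('I_m -> X) -> X)
    (x0 : X) (g : nat -> 'I_n) (x : nat -> X) (i : nat) :
  0 < m -> chaos_game f x0 g x -> m < i ->
  exists2 a : 'I_m -> nat,
    forall l, 0 < a l < i /\ i <= m * (a l).+1 &
    x i = f (g (i - 1)) (fun l => x (a l)).
Proof.
move=> m0 hx mi; have [_ _ xleaf] := hx.
have [[|b] [k h]] := H_graph_total m (leq_ltn_trans (leq0n m) mi).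
  by have [] := H_graph_gt0 m0 h.
case: k h => [/(H_graph_gt0 m0)[] //|[|k]] h.
- have mb : m <= b.
    rewrite leqNgt; apply/negP => bm.
    by move: mi; rewrite (H_graph_inj m0 h (H_graph_initial bm)) ltnS leqNgt bm.
  have [l [j' [k' [li il k1 hl]]]] := later_column_recent m0 mb h.
  pose later l := (l < i) && `[< exists j' k', 1 < k' /\ H_graph m j' k' l >].
  have bounded l' : later l' -> l' <= i by case/andP => /ltnW.
  have laterl : later l by rewrite /later li; apply/asboolP; exists j', k'.
  case: (ex_maxnP (ex_intro later l laterl) bounded) => c /andP[ci /asboolP hc].
  move=> cmax; exists (fun=> c) => [_|].
    have := cmax _ laterl; have := leq_pmull c m0; rewrite mulnS ci; lia.
  apply: (xleaf _ _ _ mi h) => // l' [l'i hl']; apply: cmax.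
  by rewrite /later l'i; apply/asboolP.
- have [t E ht] := H_graph_children m0 h.
  exists (fun l : 'I_m => t + l.+1 * tree_size m k.+1) => [l|].
    set W := tree_size m k.+1 in E *; have W0 : 0 < W by [].
    rewrite E -/W [tree_size _ _]/= -/(tree_size m k.+1) -/W.
    have lW : l.+1 * W <= m * W by rewrite leq_mul2r ltn_ord orbT.
    have lW0 : W <= l.+1 * W by rewrite leq_pmull.
    have mlW : m * W <= m * (l.+1 * W) by rewrite leq_mul2l lW0 orbT.
    move: mlW; have := leq_pmull t m0.
    by rewrite mulnS mulnDr; lia.
  pose s l := t + l.+1 * tree_size m k.+1.
  exact: (chaos_game_column (s := s) m0 hx mi h ht).
Qed.

Lemma chaos_game_invariant (X : Type) (m n : nat)
    (f : 'I_n -> ('I_m -> X) -> X) (x0 : X) (g : nat -> 'I_n) (x : nat -> X)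
    (S : set X) :
  0 < m -> chaos_game f x0 g x -> S x0 ->
  (forall c y, (forall l, S (y l)) -> S (f c y)) ->
  forall i, 0 < i -> S (x i).
Proof.
move=> m0 hx Sx0 fS; elim/ltn_ind => i IH i0.
have [im|mi] := leqP i m.
  by have [xinit _ _] := hx; rewrite xinit ?i0 ?im //; exact: fS.
have [a ai ->] := chaos_game_step m0 hx mi.
by apply: fS => l; have [/andP[al0 ali] _] := ai l; exact: IH.
Qed.

End ChaosGame.

(** * Comparison functions *)

Definition comparison_function (R : realType) (phi : R -> R) : Prop :=
  [/\ forall t, 0 <= t -> 0 <= phi t,
      forall s t, 0 <= s -> s <= t -> phi s <= phi t
    & forall t, 0 < t -> iter k phi t @[k --> \oo] --> (0 : R)].

Lemma comparison_iter_ge0 (R : realType) (phi : R -> R) t k :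
  (forall t, 0 <= t -> 0 <= phi t) -> 0 <= t -> 0 <= iter k phi t.
Proof. by move=> phi0 t0; elim: k => //= k; exact: phi0. Qed.

Lemma comparison_iter_lt (R : realType) (phi : R -> R) t e :
  comparison_function phi -> 0 < t -> 0 < e -> exists k, iter k.+1 phi t < e.
Proof.
move=> [phi0 _ cphi] t0 e0.
have /cvgrPdist_lt/(_ _ e0)[k _ /(_ k.+1 (leqnSn k))] := cphi _ t0.
rewrite sub0r normrN ger0_norm; first by exists k.
exact/comparison_iter_ge0/ltW.
Qed.

(** Otherwise t <= phi t, and by monotonicity the iterates of phi stay above
    t. *)
Lemma comparison_lt (R : realType) (phi : R -> R) t :
  comparison_function phi -> 0 < t -> phi t < t.
Proof.
move=> cphi t0; have [k0] := comparison_iter_lt cphi t0 t0.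
have [phi0 mphi _] := cphi.
move: k0.+1 => k; rewrite !ltNge; apply: contra => tphi.
elim: k => //= k IH; apply: le_trans tphi _.
by apply: mphi => //; exact: ltW.
Qed.

(** A consequence of the convergence of iterates that, unlike the latter,
    passes to maxima of finitely many functions: take for s the last iterate
    of L + 1 that is above L. *)
Lemma comparison_right (R : realType) (phi : R -> R) L :
  comparison_function phi -> 0 < L -> exists2 s, L < s & phi s <= L.
Proof.
move=> cphi L0; have [k0] := comparison_iter_lt cphi (addr_gt0 L0 ltr01) L0.
move/ltW; elim: k0.+1 => [|k IH] /=; first by rewrite leNgt ltrDl ltr01.
have [/IH//|Lk phiL] := leP (iter k phi (L + 1)) L.
by exists (iter k phi (L + 1)).
Qed.

(** The iterates decrease to a limit L. If L > 0 they eventually get below the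
    s given for L, one step later they are at most L, and then at most phi L <
    L. *)
Lemma comparison_of_right (R : realType) (phi : R -> R) :
  (forall t, 0 <= t -> 0 <= phi t) ->
  (forall s t, 0 <= s -> s <= t -> phi s <= phi t) ->
  (forall L, 0 < L -> phi L < L) ->
  (forall L, 0 < L -> exists2 s, L < s & phi s <= L) ->
  comparison_function phi.
Proof.
move=> phi0 mphi ltphi right; split=> // t t0; pose u k := iter k phi t.
have u0 k : 0 <= u k by apply: comparison_iter_ge0 => //; exact: ltW.
have phi_le s : 0 <= s -> phi s <= s.
  rewrite le_eqVlt => /orP[/eqP <-|/ltphi/ltW//].
  apply/ler_addgt0Pr => e e0; rewrite add0r.
  by apply: le_trans (ltW (ltphi _ e0)); apply: mphi => //; exact: ltW.
have du : nonincreasing_seq u by apply/nonincreasing_seqP => k; exact: phi_le.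
have cu : cvgn u.
  by apply: nonincreasing_is_cvgn => //; exists 0 => _ [k _ <-].
have Lu := nonincreasing_cvgn_ge du cu.
have L0 : 0 <= limn u by apply: limr_ge => //; exact: nearW.
suff E : limn u = 0 by rewrite -E.
apply/eqP; rewrite eq_le L0 andbT leNgt; apply/negP => {}L0.
have [s Ls phis] := right _ L0.
have [k _ /(_ k (leqnn k)) /= us] := cvgr_lt _ cu _ Ls.
have ukL : u k.+1 <= limn u.
  by apply: le_trans phis; apply: mphi => //; exact: ltW.
have := le_lt_trans (mphi _ _ (u0 k.+1) ukL) (ltphi _ L0).
by rewrite ltNge (Lu k.+2).
Qed.

Lemma comparison_max (R : realType) (n : nat) (phi : 'I_n -> R -> R) :
  (forall i, comparison_function (phi i)) ->
  comparison_function (fun t => \big[Num.max/0]_i phi i t).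
Proof.
move=> cphi; apply: comparison_of_right.
- by move=> t t0; exact: bigmax_ge_id.
- move=> s t s0 st; apply: bigmax_le => [|i _]; first exact: bigmax_ge_id.
  have [_ /(_ _ _ s0 st) le_i _] := cphi i; apply: le_trans le_i _.
  exact: (le_bigmax _ (fun i => phi i t)).
- by move=> L L0; apply: bigmax_lt => // i _; exact: comparison_lt.
- move=> L L0.
  have /choice[s /all_and2[Ls phis]] :
      forall i, exists s, L < s /\ phi i s <= L.
    by move=> i; have [s ? ?] := comparison_right (cphi i) L0; exists s.
  have Lmin : L < \big[Num.min/(L + 1)]_i s i.
    by apply/bigmin_gtP; split => [|i _]; rewrite ?ltrDl.
  exists (\big[Num.min/(L + 1)]_i s i) => //.
  apply: bigmax_le => [|i _]; first exact: ltW.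
  apply: le_trans (phis i); have [_ mphi _] := cphi i; apply: mphi.
    by rewrite (le_trans (ltW L0)) // ltW.
  exact: bigmin_le.
Qed.

Lemma common_comparison (R : realType) (X : metricType R) (m n : nat)
    (f : 'I_n -> ('I_m -> X) -> X) :
  (forall i, generalized_matkowski (f i)) ->
  exists2 psi : R -> R, comparison_function psi &
    forall i r y z, 0 <= r -> (forall l, mdist (y l) (z l) <= r) ->
      mdist (f i y) (f i z) <= psi r.
Proof.
move=> hf; have [phi hphi] := choice hf.
have cphi i : comparison_function (phi i) by have [] := hphi i.
exists (fun t => \big[Num.max/0]_i phi i t); first exact: comparison_max.
move=> i r y z r0 yz; have [_ mphi _ fi] := hphi i.
apply: le_trans (fi y z) _.
apply: le_trans (le_bigmax 0 (fun i => phi i r) i).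
apply: mphi; first exact: bigmax_ge_id.
exact: bigmax_le.
Qed.

(** * Orbits near the attractor *)

Lemma compact_mdist_bounded (R : realType) (X : metricType R) (A : set X)
    (x0 : X) :
  compact A -> exists2 D, 0 < D & forall a, A a -> mdist x0 a <= D.
Proof.
move=> cA; have [->|/set0P A0] := eqVneq A set0; first by exists 1.
have cont : {within A, continuous (mdist x0)}.
  apply: continuous_subspaceT => a.
  apply/(@cvgrPdist_lt R R^o) => e e0.
  have : \forall b \near a, mdist a b < e.
    by apply/metricType_numDomainType.nbhs_mdistP; exists e.
  apply: filterS => b ab; apply: le_lt_trans ab.
  rewrite ler_norml; have := metric_triangle x0 a b.
  by have := metric_triangle x0 b a; rewrite (metric_sym b a); lra.
have [c _ hc] := compact_EVT_max A0 cA cont.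
exists (mdist x0 c + 1) => [|a Aa].
  by rewrite ltr_wpDl ?mdist_ge0.
by rewrite (le_trans (hc _ (mem_set Aa))) // lerDl.
Qed.

(** The bound is witnessed by a point of A, which the maps can be applied to;
    the infimum of the distances to A provides none. *)
Definition fattening (R : realType) (X : metricType R) (A : set X) (r : R) :
  set X := [set y | exists2 a, A a & mdist y a <= r].

Lemma fattening_le (R : realType) (X : metricType R) (A : set X) (r s : R) :
  r <= s -> fattening A r `<=` fattening A s.
Proof. by move=> rs y [a Aa ya]; exists a => //; exact: le_trans rs. Qed.

Section Attractor.
Context {R : realType} {X : metricType R} {m n : nat}.
Context {f : 'I_n -> ('I_m -> X) -> X} {A : set X} {psi : R -> R}.
Hypotheses (m_gt0 : (0 < m)%N) (cpsi : comparison_function psi)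
  (fpsi : forall i r y z, 0 <= r -> (forall l, mdist (y l) (z l) <= r) ->
    mdist (f i y) (f i z) <= psi r)
  (fA : A = \bigcup_(i in [set: 'I_n]) (f i @` [set x | forall l, A (x l)])).

Lemma attractor_stable i y : (forall l, A (y l)) -> A (f i y).
Proof. by move=> Ay; rewrite fA; exists i => //; exists y. Qed.

Lemma attractor_decompose a : A a ->
  exists i y, a = f i y /\ forall l, A (y l).
Proof. by rewrite {1}fA => -[i _ [y Ay <-]]; exists i, y. Qed.

Lemma fattening_stable r i y : 0 <= r ->
  (forall l, fattening A r (y l)) -> fattening A (psi r) (f i y).
Proof.
move=> r0 Ay; have /choice[z /all_and2[Az yz]] :
    forall l, exists z, A z /\ mdist (y l) z <= r.
  by move=> l; have [z ? ?] := Ay l; exists z.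
by exists (f i z); [exact: attractor_stable|exact: fpsi].
Qed.

Section Orbit.
Variables (x0 : X) (g : nat -> 'I_n) (x : nat -> X) (r : R).
Hypotheses (hx : chaos_game f x0 g x) (r0 : 0 < r).

Lemma chaos_game_bounded : (fattening A r) x0 ->
  forall i, (0 < i)%N -> fattening A r (x i).
Proof.
move=> Ax0; apply: (chaos_game_invariant m_gt0 hx Ax0) => c y Ay.
apply: (fattening_le (ltW (comparison_lt cpsi r0))).
by apply: fattening_stable => //; exact: ltW.
Qed.

Lemma chaos_game_attracted : (fattening A r) x0 ->
  forall k, exists N, forall i, (N <= i)%N -> fattening A (iter k psi r) (x i).
Proof.
move=> Ax0; elim=> [|k [N IH]]; first by exists 1%N; exact: chaos_game_bounded.
exists (m * N + m).+1 => i Ni.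
have mi : (m < i)%N by apply: leq_trans Ni; rewrite ltnS leq_addl.
have [a ai ->] := chaos_game_step m_gt0 hx mi.
apply: fattening_stable => [|l].
  by apply: comparison_iter_ge0; [case: cpsi|exact: ltW].
apply: IH; have [_ /(leq_trans Ni)] := ai l.
by rewrite -mulnSr ltn_mul2l m_gt0 => /ltnW.
Qed.

End Orbit.

(** The word lists in post-order the labels of the tree obtained by unfolding
    a = f_c(y_1, ..., y_m) repeatedly: it is the concatenation of the words of
    y_1, ..., y_m followed by c. Words are functions on all of [nat], of which
    only the first [tree_size m K.+1] values count. *)
Lemma tree_word_exists r K a : 0 <= r -> A a ->
  exists w : nat -> 'I_n, forall x0 g x, chaos_game f x0 g x ->
    (forall i b, (0 < i)%N -> A b -> mdist (x i) b <= r) ->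
    forall j k t, (m <= t)%N -> tree_root m K.+1 j k (t + tree_size m K.+1) ->
      (forall l, (l < tree_size m K.+1)%N -> g (t + l)%N = w l) ->
      mdist (x (t + tree_size m K.+1)%N) a <= iter K.+1 psi r.
Proof.
move=> r0; elim: K a => [|K IH] a /attractor_decompose[c [y [-> Ay]]].
  exists (fun=> c) => x0 g x hx xr j k t mt _ gw.
  rewrite /= muln0 addn1.
  have [s si ->] := chaos_game_step m_gt0 hx (mt : (m < t.+1)%N).
  rewrite subn1 /= -[t in g t]addn0 gw ?muln0 //.
  by apply: fpsi => // l; apply: xr => //; have [/andP[]] := si l.
pose W := tree_size m K.+1.
have /choice[w hw] := fun l => IH (y l) (Ay l).
(* The position p lies in the block of child p / W, at offset p mod W; the one
   position past the last block is the root. *)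
exists (fun p => if insub (p %/ W)%N is Some l then w l (p %% W)%N else c).
move=> x0 g x hx xr j k t mt root gw.
have rW : tree_size m K.+2 = (m * W).+1 by [].
have [b [k' [jb kk' child]]] := tree_root_children m_gt0 root.
have [hroot _] := root; rewrite jb kk' in hroot.
have mi : (m < t + tree_size m K.+2)%N.
  by rewrite rW addnS ltnS (leq_trans mt) ?leq_addr.
pose s l := (t + l.+1 * W)%N.
rewrite (chaos_game_column (s := s) m_gt0 hx mi hroot); last first.
  by move=> l /child[].
have -> : g (t + tree_size m K.+2 - 1)%N = c.
  rewrite rW addnS subn1 /= gw // mulnK // insubF // ltnn //.
apply: fpsi => [|l].
  by apply: (@comparison_iter_ge0 _ _ _ K.+1); [case: cpsi|].
have E : (t + l.+1 * W = t + l * W + tree_size m K.+1)%N.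
  by rewrite mulSnr addnA.
have rootl := child _ (ltn_ord l); rewrite -/W E in rootl.
rewrite /s E; apply: (hw l x0 g x hx xr _ _ _ _ rootl) => [|p pW].
  by rewrite (leq_trans mt) ?leq_addr.
rewrite -addnA gw.
  by rewrite divnMDl // divn_small // addn0 modnMDl modn_small // valK.
rewrite rW ltnS (@leq_trans (l.+1 * W)) //; last first.
  by rewrite leq_mul2r ltn_ord orbT.
by rewrite mulSnr leq_add2l ltnW.
Qed.

End Attractor.

(** * Recurrence of words in an independent sequence of letters *)

Lemma unbounded_spaced (Q : nat -> Prop) (W M : nat) :
  (forall M, exists2 t, (M <= t)%N & Q t) ->
  exists t : nat -> nat,
    forall r, [/\ Q (t r), (M <= t r)%N & (t r + W <= t r.+1)%N].
Proof.
move=> unbQ; have /choice[next nextP] : forall M, exists t, (M <= t)%N /\ Q t.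
  by move=> N; have [t ? ?] := unbQ N; exists t.
pose t r := iter r (fun a => next (a + W)%N) (next M).
exists t => r; have tr : (t r + W <= t r.+1)%N by have [] := nextP (t r + W)%N.
split=> //; first by case: r {tr} => [|r] /=; apply: (nextP _).2.
elim: r {tr} => [|r IH] /=; first by have [] := nextP M.
by rewrite (leq_trans IH) // (leq_trans _ (nextP _).1) // leq_addr.
Qed.

Section CoinTossing.
Context {R : realType} {n : nat} {p : 'I_n.+1 -> R}.
Context {P : probability (g_sigma_algebraType (@coordinate_events 'I_n.+1)) R}.
Hypotheses (p_gt0 : forall i, 0 < p i) (sum_p : \sum_i p i = 1)
  (hP : is_product_probability p P).

Notation T := (g_sigma_algebraType (@coordinate_events 'I_n.+1)).
Implicit Types (B : nat -> {set 'I_n.+1}) (w : nat -> 'I_n.+1).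

Definition box (N : nat) B : set T :=
  [set g | forall i, (i < N)%N -> g i \in B i].

Definition occurs (w : nat -> 'I_n.+1) (W t : nat) : set T :=
  [set g | forall l, (l < W)%N -> g (t + l)%N = w l].

Lemma measurable_coordinate i a : measurable [set g : T | g i = a].
Proof. by apply: sub_sigma_algebra; exists i, a. Qed.

Lemma measurable_box N B : measurable (box N B).
Proof.
have -> : box N B = \bigcap_(i in `I_N) \bigcup_(a in [set a | a \in B i])
    [set g : T | g i = a].
  apply/seteqP; split => g /= Bg i iN; first by exists (g i) => //; exact: Bg.
  by have [a aB ->] := Bg _ iN.
apply: fin_bigcap_measurable => [|i _]; first exact: finite_II.
apply: fin_bigcup_measurable => [|a _]; first exact: finite_finset.
exact: measurable_coordinate.
Qed.

Lemma measurable_occurs w W t : measurable (occurs w W t).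
Proof.
have -> : occurs w W t = \bigcap_(l in `I_W) [set g : T | g (t + l)%N = w l].
  by apply/seteqP; split => g /=.
apply: fin_bigcap_measurable => [|i _]; first exact: finite_II.
exact: measurable_coordinate.
Qed.

Section Misses.
Variables (w : nat -> 'I_n.+1) (W : nat) (t : nat -> nat).
Hypothesis spaced : forall r, (t r + W <= t r.+1)%N.

Definition word_weight : R := \prod_(l < W) p (w l).

Fixpoint misses (s : nat) : set T :=
  if s is s'.+1 then misses s' `\` occurs w W (t s') else setT.

Lemma measurable_misses s : measurable (misses s).
Proof.
elim: s => [|s IH] /=; first exact: measurableT.
by apply: measurableD => //; exact: measurable_occurs.
Qed.

Definition pin (a : nat) B (i : nat) : {set 'I_n.+1} :=
  if (a <= i < a + W)%N then [set w (i - a)%N]%SET else B i.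

Lemma box_occurs N B s : (t s + W <= N)%N ->
  (forall i, (i < t s + W)%N -> B i = [set: 'I_n.+1]%SET) ->
  box N B `&` occurs w W (t s) = box N (pin (t s) B).
Proof.
move=> tN BT; apply/seteqP; split => g.
  move=> [Bg wg] i iN; rewrite /pin.
  case: ifPn => [/andP[ti iW]|_]; last exact: Bg.
  by rewrite inE -wg ?subnKC // ltn_subLR.
move=> Bg; split => [i iN|l lW].
  have := Bg _ iN; rewrite /pin; case: ifPn => // /andP[ti iW] _.
  by rewrite BT ?inE.
have := Bg (t s + l)%N.
rewrite /pin leq_addr ltn_add2l lW addKn => /(_ _)/set1P; apply.
by apply: leq_trans tN; rewrite ltn_add2l.
Qed.

Lemma weight_pin N B s : (t s + W <= N)%N ->
  (forall i, (i < t s + W)%N -> B i = [set: 'I_n.+1]%SET) ->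
  \prod_(i < N) \sum_(a in pin (t s) B i) p a =
  word_weight * \prod_(i < N) \sum_(a in B i) p a.
Proof.
move=> tN BT.
pose F i := if (t s <= i < t s + W)%N then p (w (i - t s)%N) else 1.
have -> : word_weight = \prod_(i < N) F i.
  have tW : (t s <= t s + W)%N by rewrite leq_addr.
  rewrite -(big_mkord xpredT F) (big_cat_nat (leq0n _) (leq_trans tW tN)) //=.
  rewrite (big_cat_nat tW tN) //= [X in X * _]big_nat big1 => [|i /andP[_ it]].
    rewrite [X in _ * (_ * X)]big_nat.
    rewrite [X in _ * (_ * X)]big1 => [|i /andP[ti _]].
      rewrite mul1r mulr1 -{1}[t s]add0n [(t s + W)%N]addnC big_addn addnK.
      rewrite big_mkord; apply: eq_bigr => l _.
      by rewrite /F leq_addl addnK addnC ltn_add2l ltn_ord.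
    by rewrite /F [(i < _)%N]ltnNge ti andbF.
  by rewrite /F leqNgt it.
rewrite -big_split /=; apply: eq_bigr => i _; rewrite /pin /F.
case: ifPn => [/andP[_ it]|_]; last by rewrite mul1r.
by rewrite big_set1 BT // (eq_bigl xpredT) ?sum_p ?mulr1 // => a; rewrite inE.
Qed.

(** Independence of the windows, in a form that the values of P on boxes give
    by induction. The event on s + 1 windows is the difference of the event on
    s windows and of its intersection with an occurrence in the last window;
    the latter, intersected with a box that leaves this window free, is the
    event on s windows intersected with another box. Carrying an arbitrary box
    beyond the windows is what makes the induction go through. *)
Lemma probability_misses_box s N B : (t s <= N)%N ->
  (forall i, (i < t s)%N -> B i = [set: 'I_n.+1]%SET) ->
  P (misses s `&` box N B) =
  ((1 - word_weight) ^+ s * \prod_(i < N) \sum_(a in B i) p a)%:E.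
Proof.
elim: s N B => [|s IH] N B tN BT.
  by rewrite /= setTI expr0 mul1r; exact: hP.
have tN' := leq_trans (spaced s) tN.
have BT' i : (i < t s + W)%N -> B i = [set: 'I_n.+1]%SET.
  by move=> it; apply: BT; exact: leq_trans (spaced s).
have tN2 : (t s <= N)%N by apply: leq_trans tN'; rewrite leq_addr.
have BT2 i : (i < t s)%N -> B i = [set: 'I_n.+1]%SET.
  by move=> it; apply: BT'; rewrite ltn_addr.
have : P (misses s `&` box N B) =
    (P ((misses s `&` box N B) `\` occurs w W (t s)) +
     P ((misses s `&` box N B) `&` occurs w W (t s)))%E.
  apply: measureDI; last exact: measurable_occurs.
  by apply: measurableI; [exact: measurable_misses|exact: measurable_box].
rewrite (IH _ _ tN2 BT2) -setIA box_occurs // IH //; last first.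
  by move=> i it; rewrite /pin leqNgt it /= BT2.
rewrite weight_pin // -/(misses _) => E.
have -> : misses s.+1 `&` box N B = (misses s `&` box N B) `\` occurs w W (t s).
  by rewrite /= !setDE setIAC.
rewrite -[LHS](@addeK _ ((1 - word_weight) ^+ s *
  (word_weight * \prod_(i < N) \sum_(a in B i) p a))%:E _) // -E -EFinB.
congr EFin.
by rewrite exprS; ring.
Qed.

Lemma probability_misses s : P (misses s) = ((1 - word_weight) ^+ s)%:E.
Proof.
have := @probability_misses_box s (t s) (fun=> [set: 'I_n.+1]%SET) (leqnn _)
  (fun _ _ => erefl).
rewrite big1 ?mulr1 => [<-|i _].
  congr (P _); apply/seteqP; split => [g ?|g []//].
  by split => // i _; rewrite inE.
by rewrite -[RHS]sum_p; apply: eq_bigl => a; rewrite inE.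
Qed.

(** The probability of missing s windows is (1 - q)^s with 0 < q <= 1, so that
    of missing all windows is 0. *)
Lemma ae_occurs : {ae P, forall g, exists r, occurs w W (t r) g}.
Proof.
have q0 : 0 < word_weight by apply: prodr_gt0.
have q1 : word_weight <= 1.
  rewrite /word_weight; apply: prodr_ile1 => l _; rewrite ltW //=.
  by rewrite -sum_p (bigD1 (w l)) //= lerDl sumr_ge0 // => i _; exact: ltW.
exists (\bigcap_s misses s); split.
- by apply: bigcapT_measurable => s; exact: measurable_misses.
- apply/eqP; rewrite eq_le measure_ge0 andbT.
  apply/lee_addgt0Pr => e e0; rewrite add0e.
  have : (1 - word_weight) ^+ s @[s --> \oo] --> (0 : R).
    by apply: cvg_expr; rewrite ger0_norm ?subr_ge0 // ltrBlDr ltrDl.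
  move=> /cvgrPdist_lt/(_ _ e0)[s _ /(_ s (leqnn s))] /=.
  rewrite sub0r normrN => /(le_lt_trans (ler_norm _))/ltW se.
  apply: le_trans (_ : P (misses s) <= _)%E; last first.
    by rewrite probability_misses lee_fin.
  apply: le_measure; rewrite ?inE //.
  + by apply: bigcapT_measurable => k; exact: measurable_misses.
  + exact: measurable_misses.
  + by move=> g; exact.
- move=> g /= none s _; elim: s => [//|s IH] /=; split => // gs.
  by apply: none; exists s.
Qed.

End Misses.

(** Applied to a sequence of disjoint windows that starts beyond M,
    [ae_occurs] gives an occurrence beyond M; there are countably many M. *)
Lemma ae_word_recurs (Q : nat -> Prop) w W :
  (forall M, exists2 t, (M <= t)%N & Q t) ->
  {ae P, forall g, forall M, exists t, [/\ (M <= t)%N, Q t & occurs w W t g]}.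
Proof.
move=> unbQ; apply/ae_foralln => M.
have [t ht] := unbounded_spaced W M unbQ.
have spaced r : (t r + W <= t r.+1)%N by have [] := ht r.
apply: filterS (ae_occurs w spaced) => g [r gr].
by exists (t r); have [? ? _] := ht r.
Qed.

End CoinTossing.

(** * Closed tails and the Hausdorff distance *)

Lemma metric_closureP (R : realType) (X : metricType R) (S : set X) (a : X) :
  closure S a <-> forall e, 0 < e -> exists2 y, S y & mdist a y < e.
Proof.
split=> [Sa e e0|Sa B /metricType_numDomainType.nbhs_mdistP[e /= e0 eB]].
  have /Sa[y [Sy ay]] : nbhs a [set y | mdist a y < e].
    by apply/metricType_numDomainType.nbhs_mdistP; exists e.
  by exists y.
by have [y Sy ay] := Sa _ e0; exists y; split => //; exact: eB.
Qed.

Section Limits.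
Context {R : realType} {X : metricType R} {A : set X} {x : nat -> X}.

Lemma dist_to_set_le (B : set X) y b :
  B b -> (dist_to_set y B <= (mdist y b)%:E)%E.
Proof. by move=> Bb; apply: ereal_inf_lbound; exists b. Qed.

Lemma dist_to_set_ge0 (B : set X) y : (0 <= dist_to_set y B)%E.
Proof. by apply: le_ereal_inf_tmp => _ [b _ <-]; rewrite lee_fin mdist_ge0. Qed.

Lemma sub_tail_closure :
  (forall a, A a -> forall e, 0 < e -> forall k,
    exists2 i, (k <= i)%N & mdist (x i) a < e) ->
  forall k, A `<=` tail_closure x k.
Proof.
move=> xA k a Aa; apply/metric_closureP => e e0.
have [i ki xia] := xA _ Aa _ e0 k.
by exists (x i); [exists i|rewrite metric_sym].
Qed.

Lemma hausdorff_cvg : A !=set0 -> (forall k, A `<=` tail_closure x k) ->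
  (forall e, 0 < e -> exists N, forall i, (N <= i)%N -> fattening A e (x i)) ->
  hausdorff_dist (tail_closure x k) A @[k --> \oo] --> 0%E.
Proof.
move=> [a0 Aa0] AK xA.
have ge0 k : (0 <= hausdorff_dist (tail_closure x k) A)%E.
  rewrite le_max; apply/orP; right.
  apply: le_trans (dist_to_set_ge0 (tail_closure x k) a0) _.
  by apply: ereal_sup_ubound; exists a0.
have le e : 0 < e ->
    \forall k \near \oo, (hausdorff_dist (tail_closure x k) A <= e%:E)%E.
  move=> e0; have e20 : 0 < e / 2 by rewrite divr_gt0.
  have [N xN] := xA _ e20; exists N => // k /= Nk.
  rewrite ge_max; apply/andP; split; apply: ge_ereal_sup => _ [y yS <-].
    have /metric_closureP/(_ _ e20)[_ [i ki <-] yxi] := yS.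
    have [a Aa xia] := xN _ (leq_trans Nk ki).
    apply: le_trans (dist_to_set_le _ Aa) _; rewrite lee_fin.
    apply: le_trans (metric_triangle _ (x i) _) _.
    by rewrite [e in _ <= e]splitr lerD // ltW.
  apply: le_trans (dist_to_set_le _ (AK k _ yS)) _.
  by rewrite mdistxx lee_fin ltW.
apply/fine_cvgP; split.
  apply: filterS (le _ ltr01) => k hk; rewrite fin_numE.
  by move: (ge0 k) hk; case: (hausdorff_dist _ _).
apply/cvgrPdist_le => e e0; apply: filterS (le _ e0) => k.
have := ge0 k; rewrite /=; case: (hausdorff_dist _ _) => //= h.
by rewrite !lee_fin sub0r normrN => /ger0_norm ->.
Qed.

Lemma tail_closure_sub : compact A -> (forall i, (0 < i)%N -> A (x i)) ->
  forall k, (1 <= k)%N -> tail_closure x k `<=` A.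
Proof.
move=> cA xA k k1; have clA := compact_closed (@metric_hausdorff _ X) cA.
rewrite /tail_closure [X in _ `<=` X](closure_id A).1 //.
by apply: closure_subset => _ [i /= ki <-]; apply: xA; exact: leq_trans ki.
Qed.

End Limits.

(** * Convergence of the chaos game *)

(** Only the first [tree_size m K.+1] values of w matter, so the quantifier
    over words is a countable one over finite sequences. *)
Lemma ae_tree_words (R : realType) (m n : nat) (p : 'I_n.+1 -> R)
    (P : probability (g_sigma_algebraType (@coordinate_events 'I_n.+1)) R) :
  (0 < m)%N -> (forall i, 0 < p i) -> \sum_i p i = 1 ->
  is_product_probability p P ->
  {ae P, forall g : nat -> 'I_n.+1, forall K (w : nat -> 'I_n.+1) M,
    exists j k t, [/\ (M <= t)%N, tree_root m K.+1 j k (t + tree_size m K.+1) &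
      forall l, (l < tree_size m K.+1)%N -> g (t + l)%N = w l]}.
Proof.
move=> m0 p0 sp hP; pose W K := tree_size m K.+1.
pose Q K t := exists j k, tree_root m K.+1 j k (t + W K).
have unbQ K M : exists2 t, (M <= t)%N & Q K t.
  have [j [k [t [Mt h]]]] := tree_root_unbounded K M m0.
  by exists t => //; exists j, k.
pose word (s : seq 'I_n.+1) l := nth ord0 s l.
have aeKs (c : nat) : {ae P, forall g : nat -> 'I_n.+1,
    if unpickle c is Some (K, s) then
      forall M, exists t, [/\ (M <= t)%N, Q K t & occurs (word s) (W K) t g]
    else True}.
  case: (unpickle c) => [[K s]|]; last exact: nearW.
  exact: (ae_word_recurs p0 sp hP).
apply: filterS (ae_foralln aeKs) => g hg K w M.
have := hg (pickle (K, mkseq w (W K))); rewrite pickleK.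
move=> /(_ M)[t [Mt [j [k root]] occ]]; exists j, k, t; split => // l lW.
by rewrite occ // /word nth_mkseq.
Qed.

Theorem theorem15 (R : realType) (X : completeMetricType R) (m n : nat)
    (f : 'I_n.+1 -> ('I_m -> X) -> X) (A : set X) (p : 'I_n.+1 -> R)
    (P : probability (g_sigma_algebraType (@coordinate_events 'I_n.+1)) R)
    (x0 : X) (x : (nat -> 'I_n.+1) -> nat -> X)
    (hm : (0 < m)%N)
    (hf : forall i, generalized_matkowski (f i))
    (hA : is_fractal f A)
    (hp : forall i, 0 < p i) (hp1 : \sum_i p i = 1)
    (hP : is_product_probability p P)
    (hx : forall g, chaos_game f x0 g (x g)) :
  {ae P, forall g : nat -> 'I_n.+1,
     hausdorff_dist (tail_closure (x g) k) A @[k --> \oo] --> 0%E} /\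
  (A x0 ->
   {ae P, forall g : nat -> 'I_n.+1,
      forall k, (1 <= k)%N -> tail_closure (x g) k = A}).
Proof.
have [psi cpsi fpsi] := common_comparison hf.
have [A0 cA fA] := hA.
have [D D0 x0A] := compact_mdist_bounded x0 cA.
have fatx0 : (fattening A D) x0.
  by have [a Aa] := A0; exists a => //; exact: x0A.
(* Going through a point of A close to the orbit and through x0; the diameter
   of A is at most 2 D. *)
have bounded g i b : (0 < i)%N -> A b -> mdist (x g i) b <= D + (D + D).
  move=> i0 Ab.
  have [a Aa xa] := chaos_game_bounded hm cpsi fpsi fA (hx g) D0 fatx0 i0.
  apply: le_trans (metric_triangle _ a _) _; apply: lerD => //.
  apply: le_trans (metric_triangle _ x0 _) _; rewrite (metric_sym a x0).
  by apply: lerD; exact: x0A.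
have attracted g e : 0 < e ->
    exists N, forall i, (N <= i)%N -> fattening A e (x g i).
  move=> e0; have [k ke] := comparison_iter_lt cpsi D0 e0.
  have [N xN] := chaos_game_attracted hm cpsi fpsi fA (hx g) D0 fatx0 k.+1.
  exists N => i /xN; apply: fattening_le; exact: ltW.
have r0 : 0 < D + (D + D) by rewrite !addr_gt0.
have aeF := ae_filter_ringOfSetsType P.
have dense : {ae P, forall g : nat -> 'I_n.+1,
    forall k, A `<=` tail_closure (x g) k}.
  apply: (@filterS _ _ aeF _ _ _ (ae_tree_words hm hp hp1 hP)) => g words.
  apply: sub_tail_closure => a Aa e e0 M.
  have [K Ke] := comparison_iter_lt cpsi r0 e0.
  have [w near_a] := tree_word_exists hm cpsi fpsi fA K (ltW r0) Aa.
  have [j [k [t [Mt root gw]]]] := words K w (maxn m M).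
  move: Mt; rewrite geq_max => /andP[mt Mt].
  exists (t + tree_size m K.+1)%N; first by rewrite (leq_trans Mt) ?leq_addr.
  apply: le_lt_trans (near_a _ _ _ (hx g) (bounded g) _ _ _ mt root gw) _.
  exact: Ke.
split; [|move=> Ax0]; apply: (@filterS _ _ aeF _ _ _ dense) => g Ax.
  exact: hausdorff_cvg A0 Ax (attracted g).
have xA := chaos_game_invariant hm (hx g) Ax0 (attractor_stable fA).
by move=> k k1; apply/seteqP; split; [exact: tail_closure_sub k1|exact: Ax].
Qed.
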